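(* Let $(X,d)$ be a metric space and $(\phi_n)$ a sequence of functions $\phi_n:X\times X\to\mathbb{R}_+$ such that $\psi\preceq^A\phi_n$ for all $n$ for some $A:\mathbb{R}^*_+\to\mathbb{R}^*_+$, where $\psi:X\times X\to\mathbb{R}_+$ is uniformly weakly triangular with modulus $\theta$, and such that $\phi_n\nearrow\phi$ uniformly with a rate $\pi$ for a function $\phi:X\times X\to\mathbb{R}_+$. Let $F:X\to\overline{\mathbb{R}}$ be given with $\mathrm{zer}F\neq\emptyset$. Let $f:\mathbb{N}\to\mathbb{N}$ be nondecreasing with $f(n)\leq n$ and let $\kappa$ be a rate of divergence for $f$. Assume that $(x_n)\subseteq X$ is partially $(\phi_n)$-$(G,H)$-quasi-Fej\'er monotone w.r.t. $\mathrm{zer}F$, $f$ and $(\varepsilon_n)$. Let $\alpha_G$ be a $G$-modulus for $G$ and $\beta_H$ an $H$-modulus for $H$. Suppose there is $\tau:\mathbb{R}^*_+\times\mathbb{N}\to\mathbb{N}$ such that $$\forall\delta>0\ \forall n\in\mathbb{N}\ \exists N\in[n;\tau(\delta,n)]\ \big(|F(x_{2f(N)})|<\delta\big).$$ Let $\rho$ be a modulus of $\phi$-regularity for $F$ w.r.t. $\mathrm{zer}F$ and $S$, where $(x_n)\subseteq S\subseteq X$, and let $\xi$ be a Cauchy rate for $\sum\varepsilon_n<\infty$. Then $(x_n)$ is $\psi$-Cauchy and $$\forall\delta>0\ \forall n,m\geq2\mu(\delta)\ \big(\psi(x_n,x_m)<\delta\big)$$ where, writing $\beta(\delta)=\frac{\beta_H(A(\theta(\delta)))}{2}$,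 $$\mu(\delta)=\tau\Big(\rho\big(\alpha_G(\beta(\delta))/2\big),\ \max\big\{\kappa(\xi(\beta(\delta))),\ \kappa\big(\pi\big(\alpha_G(\beta(\delta))/2\big)\big)\big\}\Big).$$ If $\psi$ is uniformly triangular with a modulus $\theta$, then $(x_n)$ is Cauchy with the same rate, i.e. $\forall\delta>0\ \forall n,m\geq2\mu(\delta)\ \big(d(x_n,x_m)<\delta\big)$, with $\mu$ given by the same formula in terms of this $\theta$.
   Context: $\mathbb{N}=\{0,1,2,\dots\}$, $\mathbb{R}_+=[0,\infty)$, $\mathbb{R}^*_+=(0,\infty)$, $\overline{\mathbb{R}}$ the extended reals, $[a;b]=\{a,\dots,b\}\subseteq\mathbb{N}$, $\mathrm{zer}F=\{x\in X\mid F(x)=0\}$. $G,H:\mathbb{R}_+\to\mathbb{R}_+$ and $(\varepsilon_n)\subseteq\mathbb{R}_+$ with $\sum\varepsilon_n<\infty$. - $\psi\preceq^A\phi$: $\phi(x,y)\leq A(\varepsilon)\to\psi(x,y)\leq\varepsilon$ for all $\varepsilon>0$, $x,y\in X$. - $\psi$ is uniformly weakly triangular with modulus $\theta:\mathbb{R}^*_+\to\mathbb{R}^*_+$: $\psi(y,x),\psi(y,z)\leq\theta(\varepsilon)\to\psi(x,z)\leq\varepsilon$ for all $\varepsilon>0$, $x,y,z\in X$; uniformly triangular with modulus $\theta$: under the same premise $d(x,z)\leq\varepsilon$. - $\phi_n\nearrow\phi$ uniformly with rate $\pi:\mathbb{R}^*_+\to\mathbb{N}$: $\phi_n(x,y)\leq\phi(x,y)+\varepsilon$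 for all $\varepsilon>0$, $n\geq\pi(\varepsilon)$, $x,y\in X$. - $G$- and $H$-moduli $\alpha_G,\beta_H:\mathbb{R}^*_+\to\mathbb{R}^*_+$: $a\leq\alpha_G(\varepsilon)\to G(a)\leq\varepsilon$ and $H(a)\leq\beta_H(\varepsilon)\to a\leq\varepsilon$ for all $\varepsilon>0$, $a\in\mathbb{R}_+$. - Rate of divergence $\kappa:\mathbb{N}\to\mathbb{N}$ for $f$: $f(n)\geq L$ for all $L\in\mathbb{N}$ and $n\geq\kappa(L)$. - Cauchy rate $\xi:\mathbb{R}^*_+\to\mathbb{N}$: $\sum_{i=\xi(\varepsilon)}^\infty\varepsilon_i\leq\varepsilon$ for all $\varepsilon>0$. - $(x_n)$ is partially $(\phi_n)$-$(G,H)$-quasi-Fej\'er monotone w.r.t. $\mathrm{zer}F$, $f$ and $(\varepsilon_n)$: for all $n,m\in\mathbb{N}$ and $p\in\mathrm{zer}F$: $H(\phi_{2(n+m)}(p,x_{2(n+m)}))\leq G(\phi_{2n}(p,x_{2n}))+\sum_{i=n}^{n+m-1}\varepsilon_i$ and $H(\phi_{2(n+m)+1}(p,x_{2(n+m)+1}))\leq G(\phi_{2f(n)}(p,x_{2f(n)}))+\sum_{i=f(n)}^{n+m}\varepsilon_i$. - $\rho:\mathbb{R}^*_+\to\mathbb{R}^*_+$ is a modulus of $\phi$-regularity for $F$ w.r.t. $\mathrm{zer}F$ and $S$: for all $\varepsilon>0$, $x\in S$: $|F(x)|<\rho(\varepsilon)\to\mathrm{dist}_\phi(x,\mathrm{zer}F)<\varepsilon$,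 where $\mathrm{dist}_\phi(x,\mathrm{zer}F)=\inf_{y\in\mathrm{zer}F}\phi(y,x)$. - $\psi$-Cauchy: for every $\varepsilon>0$ there is $N$ with $\psi(x_n,x_m)\leq\varepsilon$ for all $n,m\geq N$.
   Formalization: Both rate conclusions are proved with ≤ δ instead of < δ (for ψ(x_n,x_m) and for d(x_n,x_m)), because the strict bounds can fail: the moduli θ only give ≤ ε, and with a discrete 0/1 distance one can have μ(1)=0 and ψ(x_0,x_1)=1. *)

(* Defs.v *)
From HB Require Import structures.
From mathcomp Require Import all_boot all_order all_algebra.
From mathcomp Require Import all_classical all_reals all_analysis.

Set Implicit Arguments.
Unset Strict Implicit.
Unset Printing Implicit Defensive.

Import Order.TTheory GRing.Theory Num.Theory.
Import numFieldNormedType.Exports.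

Local Open Scope classical_set_scope.
Local Open Scope ring_scope.

(* [0, +oo[ and ]0, +oo[ are the types {nonneg R} and {posnum R}. *)

Section Moduli.
Context {R : realType}.
Implicit Types (G H : {nonneg R} -> {nonneg R}) (m : {posnum R} -> {posnum R}).

Definition G_modulus G m : Prop :=
  forall (e : {posnum R}) (a : {nonneg R}),
    a%:num <= (m e)%:num -> (G a)%:num <= e%:num.

Definition H_modulus H m : Prop :=
  forall (e : {posnum R}) (a : {nonneg R}),
    (H a)%:num <= (m e)%:num -> a%:num <= e%:num.

Definition rate_of_divergence (f kappa : nat -> nat) : Prop :=
  forall L n : nat, (kappa L <= n)%N -> (L <= f n)%N.

Definition cauchy_rate (eps : nat -> {nonneg R}) (xi : {posnum R} -> nat) :
    Prop :=
  forall e : {posnum R},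
    (\sum_(xi e <= i <oo) ((eps i)%:num)%:E <= (e%:num)%:E)%E.

End Moduli.

Section DistanceFunctions.
Context {R : realType} {X : Type}.
Implicit Types (phi psi : X -> X -> {nonneg R}) (A : {posnum R} -> {posnum R}).

Definition dominated A psi phi : Prop :=
  forall (e : {posnum R}) (x y : X),
    (phi x y)%:num <= (A e)%:num -> (psi x y)%:num <= e%:num.

Definition weakly_triangular psi (theta : {posnum R} -> {posnum R}) : Prop :=
  forall (e : {posnum R}) (x y z : X),
    (psi y x)%:num <= (theta e)%:num -> (psi y z)%:num <= (theta e)%:num ->
    (psi x z)%:num <= e%:num.

Definition uniform_approx (phi_ : nat -> X -> X -> {nonneg R}) phi
    (prate : {posnum R} -> nat) : Prop :=
  forall (e : {posnum R}) (n : nat), (prate e <= n)%N ->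
    forall x y : X, (phi_ n x y)%:num <= (phi x y)%:num + e%:num.

Definition psi_cauchy psi (x : nat -> X) : Prop :=
  forall e : {posnum R}, exists N : nat, forall n m : nat,
    (N <= n)%N -> (N <= m)%N -> (psi (x n) (x m))%:num <= e%:num.

Definition zer (F : X -> \bar R) : set X := [set x | F x = 0%E].

Definition dist_to phi (x : X) (Z : set X) : \bar R :=
  ereal_inf [set ((phi y x)%:num)%:E | y in Z].

Definition modulus_of_regularity phi (F : X -> \bar R) (S : set X)
    (rho : {posnum R} -> {posnum R}) : Prop :=
  forall (e : {posnum R}) (x : X), S x ->
    (`|F x| < ((rho e)%:num)%:E)%E ->
    (dist_to phi x (zer F) < (e%:num)%:E)%E.

Definition partially_quasi_fejer (phi_ : nat -> X -> X -> {nonneg R})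
    (G H : {nonneg R} -> {nonneg R}) (Z : set X) (f : nat -> nat)
    (eps : nat -> {nonneg R}) (x : nat -> X) : Prop :=
  forall (n m : nat) (p : X), Z p ->
    (H (phi_ (2 * (n + m))%N p (x (2 * (n + m))%N)))%:num
      <= (G (phi_ (2 * n)%N p (x (2 * n)%N)))%:num
         + \sum_(n <= i < n + m) (eps i)%:num
    /\
    (H (phi_ (2 * (n + m)).+1 p (x (2 * (n + m)).+1)))%:num
      <= (G (phi_ (2 * f n)%N p (x (2 * f n)%N)))%:num
         + \sum_(f n <= i < (n + m).+1) (eps i)%:num.

End DistanceFunctions.

Definition uniformly_triangular {R : realType} {X : metricType R}
    (psi : X -> X -> {nonneg R}) (theta : {posnum R} -> {posnum R}) : Prop :=
  forall (e : {posnum R}) (x y z : X),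
    (psi y x)%:num <= (theta e)%:num -> (psi y z)%:num <= (theta e)%:num ->
    mdist x z <= e%:num.

Section Rate.
Context {R : realType}.
Variables (A alphaG betaH rho : {posnum R} -> {posnum R}).
Variables (tau : {posnum R} -> nat -> nat) (kappa : nat -> nat).
Variables (prate xi : {posnum R} -> nat) (theta : {posnum R} -> {posnum R}).

Definition fejer_beta (d : {posnum R}) : {posnum R} :=
  ((betaH (A (theta d)))%:num / 2)%:pos.

(* [theta] only yields bounds of the form <= e, so the distance of two terms of
   the sequence beyond 2 * fejer_mu d is <= d and can be equal to d. *)
Definition fejer_mu (d : {posnum R}) : nat :=
  let e : {posnum R} := ((alphaG (fejer_beta d))%:num / 2)%:pos in
  tau (rho e) (maxn (kappa (xi (fejer_beta d))) (kappa (prate e))).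

End Rate.

(* Main.v *)
Require Import Defs.
From mathcomp Require Import all_boot all_order all_algebra.
From mathcomp Require Import all_classical all_reals all_analysis.
From mathcomp Require Import zify.

Set Implicit Arguments.
Unset Strict Implicit.

Import Order.TTheory GRing.Theory Num.Theory.
Import numFieldNormedType.Exports.

(** Every term of the sequence of large index is compared with one and the same
    zero [p] of [F], chosen anew for each precision [d].  Write
    [b = fejer_beta d] and [e = alphaG b / 2].

    The approximation hypothesis yields an index [N <= mu d] that is so large
    that [f N] lies beyond both [xi b] and [prate e], and for which
    [F (x (2 * f N))] is so small that regularity provides [p] with
    [phi p (x (2 * f N)) < e] ([regular_near_zero]).  Passing from [phi] to
    [phi_ (2 * f N)] costs another [e], so that [G] of this distance is at most
    [b].  The single index [2 * f N] controls both parities of the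
    quasi-Fejer inequality: the even one started at [f N] and the odd one
    started at [N].  In either case the accumulated error is part of the tail
    of the series after [xi b], hence at most [b] ([fejer_uniform_bound]).  Thus
    [H (phi_ k p (x k)) <= 2 * b = betaH (A (theta d))] for all [k >= 2 * N],
    and unwinding the moduli of [H] and of domination gives
    [psi p (x k) <= theta d] ([fejer_common_zero]).

    Since [p] is common to all such [k], one application of the triangle
    property, for [psi] or for the metric, compares any two terms. *)

Local Open Scope classical_set_scope.
Local Open Scope ring_scope.

Lemma cauchy_rate_sum_le (R : realType) (eps : nat -> {nonneg R})
    (xi : {posnum R} -> nat) (e : {posnum R}) (a b : nat) :
  cauchy_rate eps xi -> (xi e <= a)%N ->
  \sum_(a <= i < b) (eps i)%:num <= e%:num.
Proof.
move=> xiP xia.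
have [ba|/ltnW ab] := leqP b a; first by rewrite big_geq.
rewrite -lee_fin -sumEFin.
apply: le_trans (xiP e).
have eps0 i : (xi e <= i)%N -> true -> (0 <= ((eps i)%:num)%:E)%E.
  by rewrite lee_fin.
apply: le_trans (nneseries_lim_ge b eps0).
rewrite (big_cat_nat xia ab) /= leeDr//.
by apply: sume_ge0 => i _; rewrite lee_fin.
Qed.

(** The distance to the zero set is an infimum that need not be attained, but a
    strict upper bound on it is met by some zero. *)
Lemma regular_near_zero (R : realType) (X : Type)
    (phi : X -> X -> {nonneg R}) (F : X -> \bar R) (S : set X)
    (rho : {posnum R} -> {posnum R}) (e : {posnum R}) (y : X) :
  modulus_of_regularity phi F S rho -> S y ->
  (`|F y| < ((rho e)%:num)%:E)%E ->
  exists2 p, zer F p & (phi p y)%:num < e%:num.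
Proof.
move=> reg Sy Fy.
have /ereal_inf_lt[_ [p Zp <-]] := reg e y Sy Fy.
by rewrite lte_fin => lt_e; exists p.
Qed.

(** Even [k] are reached from [f N] by the first inequality, odd [k] from [N] by
    the second; both start from the distance at [2 * f N] and add up errors of
    index at least [f N] only. *)
Lemma fejer_uniform_bound (R : realType) (X : Type)
    (phi_ : nat -> X -> X -> {nonneg R}) (G H : {nonneg R} -> {nonneg R})
    (Z : set X) (f : nat -> nat) (eps : nat -> {nonneg R}) (x : nat -> X)
    (xi : {posnum R} -> nat) (b : {posnum R}) (N k : nat) (p : X) :
  partially_quasi_fejer phi_ G H Z f eps x -> cauchy_rate eps xi -> Z p ->
  (f N <= N)%N -> (xi b <= f N)%N -> (2 * N <= k)%N ->
  (G (phi_ (2 * f N)%N p (x (2 * f N)%N)))%:num <= b%:num ->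
  (H (phi_ k p (x k)))%:num <= b%:num + b%:num.
Proof.
move=> fejer xiP Zp fNN xib Nk Gb.
have [odd_k|even_k] := boolP (odd k).
- have -> : k = (2 * (N + (k./2 - N))).+1 by lia.
  have [_ le_k] := fejer N (k./2 - N)%N p Zp.
  by apply: le_trans le_k _; rewrite lerD// (cauchy_rate_sum_le _ xiP).
- have -> : k = (2 * (f N + (k./2 - f N)))%N by lia.
  have [le_k _] := fejer (f N) (k./2 - f N)%N p Zp.
  by apply: le_trans le_k _; rewrite lerD// (cauchy_rate_sum_le _ xiP).
Qed.

(** The function [theta] is arbitrary, so that the bound can be combined with
    weak as well as with uniform triangularity. *)
Lemma fejer_common_zero (R : realType) (X : Type)
    (phi_ : nat -> X -> X -> {nonneg R}) (phi psi : X -> X -> {nonneg R})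
    (A theta : {posnum R} -> {posnum R}) (prate : {posnum R} -> nat)
    (F : X -> \bar R) (f kappa : nat -> nat)
    (G H : {nonneg R} -> {nonneg R}) (eps : nat -> {nonneg R}) (x : nat -> X)
    (alphaG betaH : {posnum R} -> {posnum R})
    (tau : {posnum R} -> nat -> nat) (S : set X)
    (rho : {posnum R} -> {posnum R}) (xi : {posnum R} -> nat)
    (d : {posnum R}) :
  (forall n, dominated A psi (phi_ n)) ->
  uniform_approx phi_ phi prate ->
  (forall n, (f n <= n)%N) -> rate_of_divergence f kappa ->
  partially_quasi_fejer phi_ G H (zer F) f eps x ->
  G_modulus G alphaG -> H_modulus H betaH ->
  (forall (d : {posnum R}) n, exists N,
     (n <= N <= tau d n)%N /\ (`|F (x (2 * f N)%N)| < (d%:num)%:E)%E) ->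
  (forall n, S (x n)) -> modulus_of_regularity phi F S rho ->
  cauchy_rate eps xi ->
  exists p, forall k,
    (2 * fejer_mu A alphaG betaH rho tau kappa prate xi theta d <= k)%N ->
    (psi p (x k))%:num <= (theta d)%:num.
Proof.
move=> psi_dom phi_approx f_le f_div fejer Gmod Hmod tauP xS reg xiP.
rewrite /fejer_mu.
set b := fejer_beta A betaH theta d.
set e : {posnum R} := ((alphaG b)%:num / 2)%:pos.
set n0 := maxn _ _.
have [N [/andP[n0N Ntau] FN]] := tauP (rho e) n0.
have xi_fN : (xi b <= f N)%N.
  by apply: f_div; apply: leq_trans n0N; exact: leq_maxl.
have prate_fN : (prate e <= f N)%N.
  by apply: f_div; apply: leq_trans n0N; exact: leq_maxr.
have [p Zp phi_lt] := regular_near_zero reg (xS _) FN.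
exists p => k mu_k.
apply: (psi_dom k); apply: Hmod.
have -> : (betaH (A (theta d)))%:num = b%:num + b%:num by rewrite /b /= -splitr.
apply: (fejer_uniform_bound fejer xiP Zp (f_le N) xi_fN); first lia.
apply: Gmod.
have -> : (alphaG b)%:num = e%:num + e%:num by rewrite /e /= -splitr.
have prate_2fN : (prate e <= 2 * f N)%N by lia.
by apply: le_trans (phi_approx e _ prate_2fN _ _) _; rewrite lerD2r ltW.
Qed.

Lemma cauchy_mdist_le (R : realType) (X : metricType R) (x : nat -> X) :
  (forall e : {posnum R}, exists N, forall n m, (N <= n)%N -> (N <= m)%N ->
     mdist (x n) (x m) <= e%:num) ->
  cauchy (x @ \oo).
Proof.
move=> x_cauchy; apply/cauchy_ballP => _/posnumP[e]; near_simpl.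
(* Balls are open, hence the half. *)
have [N le_e] := x_cauchy (e%:num / 2)%:pos.
exists ([set n | (N <= n)%N], [set n | (N <= n)%N]) => /=.
  by split; exists N.
move=> [n m] /= [Nn Nm]; rewrite ballEmdist /=.
apply: le_lt_trans (le_e _ _ Nn Nm) _ => /=.
by rewrite ltr_pdivrMr// ltr_pMr// ltr1n.
Qed.

Theorem theorem6p4 (R : realType) (X : metricType R)
  (phi_ : nat -> X -> X -> {nonneg R}) (phi psi : X -> X -> {nonneg R})
  (A theta : {posnum R} -> {posnum R}) (prate : {posnum R} -> nat)
  (F : X -> \bar R) (f kappa : nat -> nat)
  (G H : {nonneg R} -> {nonneg R}) (eps : nat -> {nonneg R}) (x : nat -> X)
  (alphaG betaH : {posnum R} -> {posnum R}) (tau : {posnum R} -> nat -> nat)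
  (S : set X) (rho : {posnum R} -> {posnum R}) (xi : {posnum R} -> nat)
  (psi_dom : forall n : nat, dominated A psi (phi_ n))
  (psi_tri : weakly_triangular psi theta)
  (phi_approx : uniform_approx phi_ phi prate)
  (zerF_neq0 : zer F !=set0)
  (f_nondecr : forall n m : nat, (n <= m)%N -> (f n <= f m)%N)
  (f_le : forall n : nat, (f n <= n)%N)
  (f_div : rate_of_divergence f kappa)
  (eps_summable : (\sum_(0 <= i <oo) ((eps i)%:num)%:E < +oo)%E)
  (x_fejer : partially_quasi_fejer phi_ G H (zer F) f eps x)
  (G_mod : G_modulus G alphaG) (H_mod : H_modulus H betaH)
  (tau_approx : forall (d : {posnum R}) (n : nat), exists N : nat,
     (n <= N <= tau d n)%N /\ (`|F (x (2 * f N)%N)| < (d%:num)%:E)%E)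
  (x_in_S : forall n : nat, S (x n))
  (rho_reg : modulus_of_regularity phi F S rho)
  (xi_cauchy : cauchy_rate eps xi) :
  let mu := fejer_mu A alphaG betaH rho tau kappa prate xi in
  (psi_cauchy psi x /\
   (forall (d : {posnum R}) (n m : nat),
      (2 * mu theta d <= n)%N -> (2 * mu theta d <= m)%N ->
      (psi (x n) (x m))%:num <= d%:num))
  /\
  (forall theta' : {posnum R} -> {posnum R}, uniformly_triangular psi theta' ->
   cauchy (x @ \oo) /\
   (forall (d : {posnum R}) (n m : nat),
      (2 * mu theta' d <= n)%N -> (2 * mu theta' d <= m)%N ->
      mdist (x n) (x m) <= d%:num)).
Proof.
move=> mu.
have common_zero (th : {posnum R} -> {posnum R}) (d : {posnum R}) :
    exists p, forall k, (2 * mu th d <= k)%N ->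
      (psi p (x k))%:num <= (th d)%:num.
  exact: (fejer_common_zero th d psi_dom phi_approx f_le f_div x_fejer
            G_mod H_mod tau_approx x_in_S rho_reg xi_cauchy).
split.
- have psi_rate (d : {posnum R}) n m : (2 * mu theta d <= n)%N ->
      (2 * mu theta d <= m)%N -> (psi (x n) (x m))%:num <= d%:num.
    have [p p_near] := common_zero theta d.
    by move=> /p_near pn /p_near pm; exact: psi_tri pn pm.
  by split=> // d; exists (2 * mu theta d)%N => n m; exact: psi_rate.
- move=> theta' psi_utri.
  have mdist_rate (d : {posnum R}) n m : (2 * mu theta' d <= n)%N ->
      (2 * mu theta' d <= m)%N -> mdist (x n) (x m) <= d%:num.
    have [p p_near] := common_zero theta' d.
    by move=> /p_near pn /p_near pm; exact: psi_utri pn pm.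
  split=> //; apply: cauchy_mdist_le => d.
  by exists (2 * mu theta' d)%N => n m; exact: mdist_rate.
Qed.
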